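(* Let $\mathbb{K}$ be an infinite field of characteristic $2$. Then the ideal $\mathrm{Id}_{\mathbb{Z}_2}(\mathrm{UT}_3^{(-)}(\mathbb{K}),\Gamma(1,1))$ does not satisfy the Specht property.
   Context: $\mathrm{UT}_3^{(-)}=\mathrm{UT}_3(\mathbb{K})^{(-)}$ is the Lie algebra of upper triangular $3\times3$ matrices over $\mathbb{K}$ with bracket $[a,b]=ab-ba$; $e_{ij}$ are matrix units. $\mathbb{Z}_2=\{0,1\}$ is the cyclic group of order 2 in additive notation, and $\Gamma(1,1)$ is the $\mathbb{Z}_2$-grading on $\mathrm{UT}_3^{(-)}$ with $\deg e_{ii}=\deg e_{13}=0$ and $\deg e_{12}=\deg e_{23}=1$. $\mathcal{L}(X^{\mathbb{Z}_2})$ is the free $\mathbb{Z}_2$-graded Lie algebra over $\mathbb{K}$ freely generated by countably many variables $y_i$ ($i\in\mathbb{N}$) of degree $0$ and $z_i$ ($i\in\mathbb{N}$) of degree $1$. $\mathrm{Id}_{\mathbb{Z}_2}(\mathrm{UT}_3^{(-)},\Gamma)$ is the set of elements of $\mathcal{L}(X^{\mathbb{Z}_2})$ that vanish under every graded homomorphism to $(\mathrm{UT}_3^{(-)},\Gamma)$. A $T_{\mathbb{Z}_2}$-ideal is an ideal of $\mathcal{L}(X^{\mathbb{Z}_2})$ invariant under all graded endomorphisms. A $T_{\mathbb{Z}_2}$-ideal $I$ satisfies the Specht property if every $T_{\mathbb{Z}_2}$-ideal $J\supseteq I$ is finitely generated as a $T_{\mathbb{Z}_2}$-ideal. *)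

(* Defs.v *)
From HB Require Import structures.
From mathcomp Require Import all_boot all_order all_algebra.
From mathcomp Require Import generic_quotient.
From mathcomp Require Import boolp classical_sets cardinality.

Set Implicit Arguments.
Unset Strict Implicit.
Unset Printing Implicit Defensive.

Import GRing.Theory.

Local Open Scope classical_set_scope.
Local Open Scope ring_scope.
Local Open Scope quotient_scope.

HB.mixin Record Lmodule_isLieAlgebra (K : pzRingType) L
    of GRing.Lmodule K L := {
  lie : L -> L -> L;
  lie_linearl : forall w, linear (lie^~ w);
  lie_linearr : forall w, linear (lie w);
  liexx : forall u, lie u u = 0;
  lie_jacobi : forall u v w,
    lie u (lie v w) + lie v (lie w u) + lie w (lie u v) = 0
}.

#[short(type="lieAlgType")]
HB.structure Definition LieAlgebra (K : pzRingType) :=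
  {L of GRing.Lmodule K L & Lmodule_isLieAlgebra K L}.

Section LieTheory.
Variables (K : pzRingType) (L : lieAlgType K).
Implicit Types u v w : L.

Lemma lieDl u v w : lie (u + v) w = lie u w + lie v w.
Proof. by have := lie_linearl w 1 u v; rewrite !scale1r. Qed.

Lemma lieDr u v w : lie u (v + w) = lie u v + lie u w.
Proof. by have := lie_linearr u 1 v w; rewrite !scale1r. Qed.

Lemma lie0u u : lie 0 u = 0.
Proof. by apply: (addrI (lie 0 u)); rewrite -lieDl !addr0. Qed.

Lemma lieu0 u : lie u 0 = 0.
Proof. by apply: (addrI (lie u 0)); rewrite -lieDr !addr0. Qed.

Lemma lieZl a u v : lie (a *: u) v = a *: lie u v.
Proof. by have := lie_linearl v a u 0; rewrite !addr0 lie0u addr0. Qed.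

Lemma lieZr a u v : lie u (a *: v) = a *: lie u v.
Proof. by have := lie_linearr u a v 0; rewrite !addr0 lieu0 addr0. Qed.

Lemma lieC u v : lie v u = - lie u v.
Proof.
apply/eqP; rewrite -addr_eq0; apply/eqP.
have := liexx (v + u); rewrite lieDl !lieDr !liexx add0r addr0.
by [].
Qed.

End LieTheory.

(* Direct sum decompositions L = L_0 (+) L_1 with [L_g, L_h] <= L_(g+h). *)
Record z2_grading (K : pzRingType) (L : lieAlgType K) := Z2Grading {
  gcomp :> 'Z_2 -> set L;
  gcomp0 : forall g, gcomp g 0;
  gcompZD : forall g a u v, gcomp g u -> gcomp g v -> gcomp g (a *: u + v);
  gcomp_lie : forall g h u v, gcomp g u -> gcomp h v -> gcomp (g + h) (lie u v);
  gcomp_sum : forall u, exists u0 u1, [/\ gcomp 0 u0, gcomp 1 u1 & u = u0 + u1];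
  gcomp_cap : forall u, gcomp 0 u -> gcomp 1 u -> u = 0
}.

Record graded_hom (K : pzRingType) (L M : lieAlgType K)
    (G : z2_grading L) (H : z2_grading M) (f : {linear L -> M}) : Prop := {
  graded_hom_lie : forall u v, f (lie u v) = lie (f u) (f v);
  graded_hom_deg : forall g u, G g u -> H g (f u)
}.

(* The free Lie algebra on X: Lie polynomials modulo the congruence generated
   by the axioms of Lie algebras. *)
Section LieTerms.
Variables (K : pzRingType) (X : Type).

Inductive lterm : Type :=
| LVar of X
| LZero
| LOpp of lterm
| LAdd of lterm & lterm
| LScale of K & lterm
| LLie of lterm & lterm.

HB.instance Definition _ := gen_eqMixin lterm.
HB.instance Definition _ := gen_choiceMixin lterm.

Inductive lie_eq : lterm -> lterm -> Prop :=
| lie_eq_refl t : lie_eq t t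
| lie_eq_sym t u : lie_eq t u -> lie_eq u t
| lie_eq_trans u t v : lie_eq t u -> lie_eq u v -> lie_eq t v
| lie_eq_opp t t' : lie_eq t t' -> lie_eq (LOpp t) (LOpp t')
| lie_eq_add t t' u u' :
    lie_eq t t' -> lie_eq u u' -> lie_eq (LAdd t u) (LAdd t' u')
| lie_eq_scale a t t' : lie_eq t t' -> lie_eq (LScale a t) (LScale a t')
| lie_eq_lie t t' u u' :
    lie_eq t t' -> lie_eq u u' -> lie_eq (LLie t u) (LLie t' u')
| lie_eq_addA t u v : lie_eq (LAdd t (LAdd u v)) (LAdd (LAdd t u) v)
| lie_eq_addC t u : lie_eq (LAdd t u) (LAdd u t)
| lie_eq_add0 t : lie_eq (LAdd LZero t) t
| lie_eq_addN t : lie_eq (LAdd (LOpp t) t) LZero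
| lie_eq_scaleA a b t : lie_eq (LScale a (LScale b t)) (LScale (a * b) t)
| lie_eq_scale1 t : lie_eq (LScale 1 t) t
| lie_eq_scaleDr a t u :
    lie_eq (LScale a (LAdd t u)) (LAdd (LScale a t) (LScale a u))
| lie_eq_scaleDl a b t :
    lie_eq (LScale (a + b) t) (LAdd (LScale a t) (LScale b t))
| lie_eq_linearl a t u v :
    lie_eq (LLie (LAdd (LScale a t) u) v)
       (LAdd (LScale a (LLie t v)) (LLie u v))
| lie_eq_linearr a t u v :
    lie_eq (LLie v (LAdd (LScale a t) u))
       (LAdd (LScale a (LLie v t)) (LLie v u))
| lie_eq_alt t : lie_eq (LLie t t) LZero
| lie_eq_jacobi t u v :
    lie_eq (LAdd (LAdd (LLie t (LLie u v)) (LLie u (LLie v t)))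
                 (LLie v (LLie t u))) LZero.

Definition lie_eqb : rel lterm := fun t u => `[< lie_eq t u >].

Lemma lie_eqb_equiv : equiv_class_of lie_eqb.
Proof.
split=> [t|t u|u t v].
- exact/asboolP/lie_eq_refl.
- by apply/asboolP/asboolP; apply: lie_eq_sym.
- by move=> /asboolP tu /asboolP uv; apply/asboolP/(lie_eq_trans tu uv).
Qed.

Canonical lie_equiv := EquivRelPack lie_eqb_equiv.

Definition freeLie := {eq_quot lie_equiv}.

HB.instance Definition _ : EqQuotient lterm lie_equiv freeLie :=
  EqQuotient.on freeLie.
HB.instance Definition _ := Choice.on freeLie.

End LieTerms.

Arguments LVar {K X}.
Arguments LZero {K X}.

Section FreeLieAlgebra.
Variables (K : pzRingType) (X : Type).
Local Notation T := (lterm K X).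
Local Notation L := (freeLie K X).

Lemma freeLieP (t u : T) : reflect (lie_eq t u) (\pi_L t == \pi_L u).
Proof. by rewrite piE; apply: asboolP. Qed.

Lemma pi_freeLie (t u : T) : lie_eq t u -> \pi_L t = \pi_L u.
Proof. by move=> tu; apply/eqP/freeLieP. Qed.

Lemma repr_freeLie (t : T) : lie_eq (repr (\pi_L t)) t.
Proof. by apply/freeLieP; rewrite reprK. Qed.

Definition fl_gen (x : X) : L := \pi_L (LVar x).
Definition fl_zero : L := \pi_L LZero.
Definition fl_opp (u : L) : L := locked (\pi_L (LOpp (repr u))).
Definition fl_add (u v : L) : L := locked (\pi_L (LAdd (repr u) (repr v))).
Definition fl_scale (a : K) (u : L) : L := locked (\pi_L (LScale a (repr u))).
Definition fl_lie (u v : L) : L := locked (\pi_L (LLie (repr u) (repr v))).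

Lemma pi_opp t : fl_opp (\pi_L t) = \pi_L (LOpp t).
Proof. rewrite /fl_opp -lock; exact/pi_freeLie/lie_eq_opp/repr_freeLie. Qed.

Lemma pi_add t u : fl_add (\pi_L t) (\pi_L u) = \pi_L (LAdd t u).
Proof.
by rewrite /fl_add -lock; apply/pi_freeLie/lie_eq_add;
  apply: repr_freeLie.
Qed.

Lemma pi_scale a t : fl_scale a (\pi_L t) = \pi_L (LScale a t).
Proof. rewrite /fl_scale -lock; exact/pi_freeLie/lie_eq_scale/repr_freeLie. Qed.

Lemma pi_lie t u : fl_lie (\pi_L t) (\pi_L u) = \pi_L (LLie t u).
Proof.
by rewrite /fl_lie -lock; apply/pi_freeLie/lie_eq_lie;
  apply: repr_freeLie.
Qed.

Let piE := (pi_opp, pi_add, pi_scale, pi_lie).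

Lemma fl_addA : associative fl_add.
Proof.
elim/quotW=> t; elim/quotW=> u; elim/quotW=> v; rewrite !piE.
apply/pi_freeLie; apply: lie_eq_addA.
Qed.

Lemma fl_addC : commutative fl_add.
Proof.
elim/quotW=> t; elim/quotW=> u; rewrite !piE; apply/pi_freeLie;
  apply: lie_eq_addC.
Qed.

Lemma fl_add0 : left_id fl_zero fl_add.
Proof.
by elim/quotW=> t; rewrite !piE; apply/pi_freeLie;
  apply: lie_eq_add0.
Qed.

Lemma fl_addN : left_inverse fl_zero fl_opp fl_add.
Proof.
by elim/quotW=> t; rewrite !piE; apply/pi_freeLie;
  apply: lie_eq_addN.
Qed.

HB.instance Definition _ :=
  GRing.isZmodule.Build L fl_addA fl_addC fl_add0 fl_addN.

Lemma fl_scaleA a b u : fl_scale a (fl_scale b u) = fl_scale (a * b) u.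
Proof.
by elim/quotW: u => t; rewrite !piE; apply/pi_freeLie;
  apply: lie_eq_scaleA.
Qed.

Lemma fl_scale1 : left_id 1 fl_scale.
Proof.
by elim/quotW=> t; rewrite !piE; apply/pi_freeLie;
  apply: lie_eq_scale1.
Qed.

Lemma fl_scaleDr : right_distributive fl_scale +%R.
Proof.
move=> a; elim/quotW=> t; elim/quotW=> u; rewrite /GRing.add /= !piE.
apply/pi_freeLie; apply: lie_eq_scaleDr.
Qed.

Lemma fl_scaleDl u : {morph fl_scale^~ u : a b / a + b}.
Proof.
elim/quotW: u => t a b; rewrite /= {2}/GRing.add /= !piE.
apply/pi_freeLie; apply: lie_eq_scaleDl.
Qed.

HB.instance Definition _ := GRing.Zmodule_isLmodule.Build K L
  fl_scaleA fl_scale1 fl_scaleDr fl_scaleDl.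

Lemma fl_lie_linearl w : linear (fl_lie^~ w).
Proof.
move=> a; elim/quotW=> t; elim/quotW=> u; elim/quotW: w => v.
rewrite /GRing.add /GRing.scale /= !piE.
apply/pi_freeLie; apply: lie_eq_linearl.
Qed.

Lemma fl_lie_linearr w : linear (fl_lie w).
Proof.
move=> a; elim/quotW=> t; elim/quotW=> u; elim/quotW: w => v.
rewrite /GRing.add /GRing.scale /= !piE.
apply/pi_freeLie; apply: lie_eq_linearr.
Qed.

Lemma fl_liexx u : fl_lie u u = 0.
Proof.
by elim/quotW: u => t; rewrite !piE; apply/pi_freeLie;
  apply: lie_eq_alt.
Qed.

Lemma fl_lie_jacobi u v w :
  fl_lie u (fl_lie v w) + fl_lie v (fl_lie w u) + fl_lie w (fl_lie u v) = 0.
Proof.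
elim/quotW: u => t; elim/quotW: v => u; elim/quotW: w => v.
rewrite /GRing.add /= !piE; apply/pi_freeLie; apply: lie_eq_jacobi.
Qed.

HB.instance Definition _ := Lmodule_isLieAlgebra.Build K L
  fl_lie_linearl fl_lie_linearr fl_liexx fl_lie_jacobi.

Lemma pi0E : \pi_L LZero = 0. Proof. by []. Qed.
Lemma piNE t : \pi_L (LOpp t) = - \pi_L t. Proof. by rewrite -pi_opp. Qed.
Lemma piDE t u : \pi_L (LAdd t u) = \pi_L t + \pi_L u.
Proof. by rewrite -pi_add. Qed.
Lemma piZE a t : \pi_L (LScale a t) = a *: \pi_L t.
Proof. by rewrite -pi_scale. Qed.
Lemma piLE t u : \pi_L (LLie t u) = lie (\pi_L t) (\pi_L u).
Proof. by rewrite -pi_lie. Qed.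

Lemma freeLie_ind (P : L -> Prop) :
  (forall x, P (fl_gen x)) -> P 0 ->
  (forall u v, P u -> P v -> P (u + v)) ->
  (forall a u, P u -> P (a *: u)) ->
  (forall u v, P u -> P v -> P (lie u v)) ->
  forall u, P u.
Proof.
move=> Pgen P0 PD PZ PL; elim/quotW.
elim=> [x||t|t Pt u Pu|a t Pt|t Pt u Pu].
- exact: Pgen.
- exact: P0.
- by move=> Pt; rewrite piNE -scaleN1r; apply: PZ.
- by rewrite piDE; apply: PD.
- by rewrite piZE; apply: PZ.
- by rewrite piLE; apply: PL.
Qed.

Section Universal.
Variables (M : lieAlgType K) (f : X -> M).

Fixpoint leval (t : T) : M :=
  match t with
  | LVar x => f x
  | LZero => 0
  | LOpp t => - leval t
  | LAdd t u => leval t + leval u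
  | LScale a t => a *: leval t
  | LLie t u => lie (leval t) (leval u)
  end.

Lemma leval_lie_eq t u : lie_eq t u -> leval t = leval u.
Proof.
elim=> {t u} //=.
- by move=> u t v _ -> _ ->.
- by move=> t u _ ->.
- by move=> t t' u u' _ -> _ ->.
- by move=> a t t' _ ->.
- by move=> t t' u u' _ -> _ ->.
- by move=> t u v; rewrite addrA.
- by move=> t u; rewrite addrC.
- by move=> t; rewrite add0r.
- by move=> t; rewrite addNr.
- by move=> a b t; rewrite scalerA.
- by move=> t; rewrite scale1r.
- by move=> a t u; rewrite scalerDr.
- by move=> a b t; rewrite scalerDl.
- by move=> a t u v; rewrite lie_linearl.
- by move=> a t u v; rewrite lie_linearr.
- by move=> t; rewrite liexx.
- by move=> t u v; rewrite lie_jacobi.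
Qed.

Definition fl_lift (u : L) : M := leval (repr u).

Lemma fl_lift_pi t : fl_lift (\pi_L t) = leval t.
Proof. exact/leval_lie_eq/repr_freeLie. Qed.

Lemma fl_lift_linear : linear fl_lift.
Proof.
by move=> a; elim/quotW=> t; elim/quotW=> u; rewrite -piZE -piDE !fl_lift_pi.
Qed.

HB.instance Definition _ := GRing.isLinear.Build K L M _ fl_lift fl_lift_linear.

Lemma fl_lift_lie u v : fl_lift (lie u v) = lie (fl_lift u) (fl_lift v).
Proof.
by elim/quotW: u => t; elim/quotW: v => u; rewrite -piLE !fl_lift_pi.
Qed.

Lemma fl_lift_gen x : fl_lift (fl_gen x) = f x.
Proof. exact: fl_lift_pi. Qed.

Lemma fl_lift_unique (h : {linear L -> M}) :
  (forall u v, h (lie u v) = lie (h u) (h v)) ->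
  (forall x, h (fl_gen x) = f x) -> h =1 fl_lift.
Proof.
move=> hL hX; elim/freeLie_ind=> [x||u v hu hv|a u hu|u v hu hv].
- by rewrite hX fl_lift_gen.
- by rewrite !linear0.
- by rewrite !linearD /= hu hv.
- by rewrite !linearZ /= hu.
- by rewrite hL fl_lift_lie hu hv.
Qed.

End Universal.

End FreeLieAlgebra.

(* L (x) K[Z_2], where (u, v) stands for u (x) 1 + v (x) s with s ^ 2 = 1. *)
Section GroupExtension.
Variables (K : pzRingType) (L : lieAlgType K).

Definition z2ext := (L * L)%type.
HB.instance Definition _ := GRing.Lmodule.on z2ext.

Definition z2ext_lie (x y : z2ext) : z2ext :=
  (lie x.1 y.1 + lie x.2 y.2, lie x.1 y.2 + lie x.2 y.1).

Lemma z2ext_lie_linearl w : linear (z2ext_lie^~ w).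
Proof.
move=> a x y; rewrite /z2ext_lie.
by congr pair; rewrite /= !lieDl !lieZl scalerDr addrACA.
Qed.

Lemma z2ext_lie_linearr w : linear (z2ext_lie w).
Proof.
move=> a x y; rewrite /z2ext_lie.
by congr pair; rewrite /= !lieDr !lieZr scalerDr addrACA.
Qed.

Lemma z2ext_liexx x : z2ext_lie x x = 0.
Proof. by rewrite /z2ext_lie !liexx addr0 (lieC x.1 x.2) addrN. Qed.

Lemma z2ext_jacobi u v w :
  z2ext_lie u (z2ext_lie v w) + z2ext_lie v (z2ext_lie w u)
    + z2ext_lie w (z2ext_lie u v) = 0.
Proof.
case: u v w => [u0 u1] [v0 v1] [w0 w1]; rewrite /z2ext_lie /=.
congr pair; rewrite /= !lieDr.
- rewrite (AC ((2*2)*(2*2)*(2*2)) ((1*5*9)*(2*8*11)*(3*6*12)*(4*7*10))) /=.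
  by rewrite !lie_jacobi !addr0.
- rewrite (AC ((2*2)*(2*2)*(2*2)) ((1*6*11)*(2*7*9)*(3*5*10)*(4*8*12))) /=.
  by rewrite !lie_jacobi !addr0.
Qed.

HB.instance Definition _ := Lmodule_isLieAlgebra.Build K z2ext
  z2ext_lie_linearl z2ext_lie_linearr z2ext_liexx z2ext_jacobi.

Definition z2ext_in (g : 'Z_2) (u : L) : z2ext :=
  if g == 0 then (u, 0) else (0, u).

Lemma z2ext_in0 g : z2ext_in g 0 = 0.
Proof. by rewrite /z2ext_in; case: ifP. Qed.

Lemma z2ext_inZD g a u v :
  z2ext_in g (a *: u + v) = a *: z2ext_in g u + z2ext_in g v.
Proof.
by rewrite /z2ext_in; case: ifP => _; congr pair; rewrite /= ?scaler0 ?addr0.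
Qed.

Lemma z2ext_in_lie g h u v :
  lie (z2ext_in g u) (z2ext_in h v) = z2ext_in (g + h) (lie u v).
Proof.
have Z2P (k : 'Z_2) : (k = 0) \/ (k = 1).
  by case: k => [[|[|//]] k2]; [left|right]; apply: val_inj.
by case: (Z2P g) => ->; case: (Z2P h) => ->; rewrite /z2ext_in /=;
  congr pair; rewrite /= ?lie0u ?lieu0 ?addr0 ?add0r.
Qed.

End GroupExtension.

(* y_i has degree 0 and z_i has degree 1. *)
Inductive gvar := yvar of nat | zvar of nat.

Definition gvar_deg (x : gvar) : 'Z_2 :=
  match x with yvar _ => 0 | zvar _ => 1 end.

Section FreeGrading.
Variable K : pzRingType.
Local Notation L := (freeLie K gvar).

(* The least family of subspaces compatible with the bracket such that every
   variable x lies in the component of index gvar_deg x. *)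
Inductive free_comp : 'Z_2 -> set L :=
| free_comp_gen x : free_comp (gvar_deg x) (fl_gen K x)
| free_comp0 g : free_comp g 0
| free_compZD g a u v :
    free_comp g u -> free_comp g v -> free_comp g (a *: u + v)
| free_comp_lie g h u v :
    free_comp g u -> free_comp h v -> free_comp (g + h) (lie u v).

Lemma free_comp_sum u :
  exists u0 u1, [/\ free_comp 0 u0, free_comp 1 u1 & u = u0 + u1].
Proof.
have compD g (v w : L) : free_comp g v -> free_comp g w -> free_comp g (v + w).
  by move=> vg wg; rewrite -[v]scale1r; apply: free_compZD.
have L_eq (g h k : 'Z_2) (v w : L) : free_comp g v -> free_comp h w ->
    g + h = k -> free_comp k (lie v w).
  by move=> vg wh <-; apply: free_comp_lie.
elim/freeLie_ind: u => [x||u v|a u|u v].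
- case: x => n; [exists (fl_gen K (yvar n)), 0|exists 0, (fl_gen K (zvar n))].
  + split; [exact: (free_comp_gen (yvar n))|exact: free_comp0|by rewrite addr0].
  + split; [exact: free_comp0|exact: (free_comp_gen (zvar n))|by rewrite add0r].
- by exists 0, 0; split; rewrite ?addr0 //; apply: free_comp0.
- move=> [u0 [u1 [h0 h1 ->]]] [v0 [v1 [k0 k1 ->]]].
  exists (u0 + v0), (u1 + v1).
  by split; [exact: compD|exact: compD|exact: addrACA].
- move=> [u0 [u1 [h0 h1 ->]]]; exists (a *: u0), (a *: u1).
  have compZ g (v : L) : free_comp g v -> free_comp g (a *: v).
    by move=> vg; rewrite -[_ *: _]addr0; apply: free_compZD vg (free_comp0 g).
  by rewrite scalerDr; split=> //; apply: compZ.
- move=> [u0 [u1 [h0 h1 ->]]] [v0 [v1 [k0 k1 ->]]].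
  exists (lie u0 v0 + lie u1 v1), (lie u0 v1 + lie u1 v0); split.
  + apply: compD; first by apply: (L_eq _ _ _ _ _ h0 k0); apply: val_inj.
    by apply: (L_eq _ _ _ _ _ h1 k1); apply: val_inj.
  + apply: compD; first by apply: (L_eq _ _ _ _ _ h0 k1); apply: val_inj.
    by apply: (L_eq _ _ _ _ _ h1 k0); apply: val_inj.
  + by rewrite !lieDl !lieDr [lie u1 v0 + _]addrC addrACA.
Qed.

Definition free_z2ext : {linear L -> z2ext L} :=
  @fl_lift K gvar (z2ext L) (fun x => z2ext_in (gvar_deg x) (fl_gen K x)).

Lemma free_comp_z2ext g u : free_comp g u -> free_z2ext u = z2ext_in g u.
Proof.
elim=> {g u} [x|g|g a u v _ hu _ hv|g h u v _ hu _ hv].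
- exact: fl_lift_gen.
- by rewrite linear0 z2ext_in0.
- by rewrite linearP hu hv z2ext_inZD.
- by rewrite [LHS]fl_lift_lie -z2ext_in_lie -hu -hv.
Qed.

Lemma free_comp_cap u : free_comp 0 u -> free_comp 1 u -> u = 0.
Proof.
move=> /free_comp_z2ext h0 /free_comp_z2ext; rewrite h0 /z2ext_in /=.
by case.
Qed.

Definition free_grading : z2_grading L :=
  Z2Grading free_comp0 free_compZD free_comp_lie free_comp_sum free_comp_cap.

End FreeGrading.

Section TIdeals.
Variable K : pzRingType.
Local Notation L := (freeLie K gvar).

Record T_ideal (J : set L) : Prop := {
  T_ideal0 : J 0;
  T_idealZD : forall a u v, J u -> J v -> J (a *: u + v);
  T_ideal_lie : forall u v, J v -> J (lie u v);
  T_ideal_end : forall f : {linear L -> L},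
    graded_hom (free_grading K) (free_grading K) f -> forall u, J u -> J (f u)
}.

Definition finitely_generated_T_ideal (J : set L) : Prop :=
  exists2 S : set L, finite_set S & J = smallest T_ideal S.

Definition specht_property (I : set L) : Prop :=
  forall J, T_ideal J -> I `<=` J -> finitely_generated_T_ideal J.

Definition graded_identities (A : lieAlgType K) (G : z2_grading A) : set L :=
  [set u | forall f : {linear L -> A},
    graded_hom (free_grading K) G f -> f u = 0].

Lemma graded_identities_T_ideal (A : lieAlgType K) (G : z2_grading A) :
  T_ideal (graded_identities G).
Proof.
split=> [f _|a u v hu hv f hf|u v hv f hf|f hf u hu h hh].
- exact: linear0.
- by rewrite linearP hu // hv // scaler0 addr0.
- by rewrite (graded_hom_lie hf) hv // lieu0.
- apply: (hu (h \o f)%FUN); split=> [v w|g v /(graded_hom_deg hf)] /=.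
  + by rewrite (graded_hom_lie hf) (graded_hom_lie hh).
  + exact: (graded_hom_deg hh).
Qed.

End TIdeals.

Section UpperTriangular.
Variable K : comNzRingType.

Definition upper_trig_mx n : pred 'M[K]_n := fun A => is_trig_mx A^T.
Arguments upper_trig_mx n : clear implicits.

Lemma upper_trig_mxP n (A : 'M[K]_n) :
  reflect (forall i j : 'I_n, (j < i)%N -> A i j = 0) (A \in upper_trig_mx n).
Proof.
apply: (iffP is_trig_mxP) => hA i j ij; first by have := hA j i ij; rewrite mxE.
by rewrite mxE hA.
Qed.

Lemma upper_trig_mx_submod n : submod_closed (upper_trig_mx n).
Proof.
split=> [|a A B /upper_trig_mxP hA /upper_trig_mxP hB].
  by apply/upper_trig_mxP => i j _; rewrite mxE.
by apply/upper_trig_mxP => i j ij; rewrite !mxE hA // hB // mulr0 addr0.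
Qed.

HB.instance Definition _ n :=
  GRing.isSubmodClosed.Build K 'M[K]_n (upper_trig_mx n)
    (upper_trig_mx_submod n).

Record UT n := MkUT { ut_val :> 'M[K]_n; _ : ut_val \in upper_trig_mx n }.

HB.instance Definition _ n := [isSub for @ut_val n].
HB.instance Definition _ n := [Choice of UT n by <:].
HB.instance Definition _ n := [SubChoice_isSubLmodule of UT n by <:].

Section Bracket.
Variable n : nat.
Implicit Types A B C : UT n.

Lemma ut_bracket_subproof A B :
  (A : 'M[K]_n) *m B - (B : 'M[K]_n) *m A \in upper_trig_mx n.
Proof.
have M C D : (C : 'M[K]_n) *m (D : UT n) \in upper_trig_mx n.
  case: C D => [C /upper_trig_mxP hC] [D /upper_trig_mxP hD] /=.
  apply/upper_trig_mxP => i j ij; rewrite mxE big1 // => k _.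
  case: (ltnP k i) => [ki|ik]; first by rewrite hC ?mul0r.
  by rewrite hD ?mulr0 // (leq_trans ij ik).
exact: rpredB.
Qed.

Definition ut_bracket A B : UT n := MkUT (ut_bracket_subproof A B).

Lemma ut_bracket_linearl C : linear (ut_bracket^~ C).
Proof.
move=> a A B; apply: val_inj; rewrite /= mulmxDl mulmxDr.
by rewrite -scalemxAl -scalemxAr scalerBr opprD addrACA.
Qed.

Lemma ut_bracket_linearr C : linear (ut_bracket C).
Proof.
move=> a A B; apply: val_inj; rewrite /= mulmxDl mulmxDr.
by rewrite -scalemxAl -scalemxAr scalerBr opprD addrACA.
Qed.

Lemma ut_bracketxx A : ut_bracket A A = 0.
Proof. by apply: val_inj; rewrite /= addrN. Qed.

Lemma ut_bracket_jacobi A B C :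
  ut_bracket A (ut_bracket B C) + ut_bracket B (ut_bracket C A)
    + ut_bracket C (ut_bracket A B) = 0.
Proof.
apply: val_inj; rewrite /= !mulmxBl !mulmxBr !mulmxA !opprB.
rewrite (AC ((2*2)*(2*2)*(2*2))
  ((1*12)*(7*2)*(3*10)*(5*4)*(11*6)*(9*8))) /=.
by rewrite !addrN !addr0.
Qed.

HB.instance Definition _ := Lmodule_isLieAlgebra.Build K (UT n)
  ut_bracket_linearl ut_bracket_linearr ut_bracketxx ut_bracket_jacobi.

End Bracket.

Lemma ut_lower n (A : UT n) (i j : 'I_n) : (j < i)%N -> A i j = 0.
Proof. by have /upper_trig_mxP := valP A; apply. Qed.

(* On upper triangular matrices this means that A is a combination of the
   matrix units e_ij, i <= j, with j - i = g mod 2: thus deg e_ii = deg e_13 = 0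
   and deg e_12 = deg e_23 = 1. *)
Definition Gamma11_comp (g : 'Z_2) : set (UT 3) :=
  [set A | forall i j : 'I_3, A i j != 0 -> (j - i)%:R = g].

Lemma Gamma11_comp0 g : Gamma11_comp g 0.
Proof. by move=> i j; rewrite mxE eqxx. Qed.

Lemma Gamma11_compZD g a A B :
  Gamma11_comp g A -> Gamma11_comp g B -> Gamma11_comp g (a *: A + B).
Proof.
move=> hA hB i j; have [Aij|/hA //] := eqVneq (A i j) 0.
have [Bij|/hB //] := eqVneq (B i j) 0.
by rewrite !mxE Aij Bij mulr0 addr0 eqxx.
Qed.

Lemma Gamma11_mul g h A B i j : Gamma11_comp g A -> Gamma11_comp h B ->
  ((A : 'M[K]_3) *m B) i j != 0 -> (j - i)%:R = g + h.
Proof.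
move=> hA hB; rewrite mxE => /eqP AB.
case: (pickP (fun k => A i k * B k j != 0)) => [k|AB0]; last first.
  by case: AB; apply: big1 => k _; apply/eqP; have /negbFE := AB0 k.
move=> ABk; have Aik : A i k != 0.
  by apply: contraNneq ABk => ->; rewrite mul0r.
have Bkj : B k j != 0 by apply: contraNneq ABk => ->; rewrite mulr0.
have ik : (i <= k)%N.
  by rewrite leqNgt; apply: contraNN Aik => /ut_lower ->.
have kj : (k <= j)%N.
  by rewrite leqNgt; apply: contraNN Bkj => /ut_lower ->.
by rewrite -(hA _ _ Aik) -(hB _ _ Bkj) -natrD addnC addnBA // subnK.
Qed.

Lemma Gamma11_comp_lie g h A B :
  Gamma11_comp g A -> Gamma11_comp h B -> Gamma11_comp (g + h) (lie A B).
Proof.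
move=> hA hB i j; rewrite mxE.
have [AB|/(Gamma11_mul hA hB) //] := eqVneq (((A : 'M[K]_3) *m B) i j) 0.
rewrite [X in _ + X]mxE AB add0r oppr_eq0 => /(Gamma11_mul hB hA) ->.
by rewrite addrC.
Qed.

Lemma Gamma11_part_subproof (g : 'Z_2) (A : UT 3) :
  \matrix_(i, j) (if (j - i)%:R == g then A i j else 0) \in upper_trig_mx 3.
Proof.
by apply/upper_trig_mxP => i j ij; rewrite mxE ut_lower // if_same.
Qed.

Lemma Gamma11_comp_sum A :
  exists A0 A1, [/\ Gamma11_comp 0 A0, Gamma11_comp 1 A1 & A = A0 + A1].
Proof.
exists (MkUT (Gamma11_part_subproof 0 A)), (MkUT (Gamma11_part_subproof 1 A)).
split.
- by move=> i j; rewrite mxE; case: ifP => [/eqP //|_]; rewrite eqxx.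
- by move=> i j; rewrite mxE; case: ifP => [/eqP //|_]; rewrite eqxx.
- apply/val_inj/matrixP => i j; rewrite !mxE.
  have Z2P (k : 'Z_2) : (k = 0) \/ (k = 1).
    by case: k => [[|[|//]] k2]; [left|right]; apply: val_inj.
  by case: (Z2P (j - i)%:R) => ->; rewrite /= ?addr0 ?add0r.
Qed.

Lemma Gamma11_comp_cap A : Gamma11_comp 0 A -> Gamma11_comp 1 A -> A = 0.
Proof.
move=> h0 h1; apply/val_inj/matrixP => i j; rewrite [RHS]mxE.
by apply/eqP/negPn/negP => Aij; have := h0 _ _ Aij; rewrite (h1 _ _ Aij).
Qed.

Definition Gamma11 : z2_grading (UT 3) :=
  Z2Grading Gamma11_comp0 Gamma11_compZD Gamma11_comp_lie Gamma11_comp_sum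
    Gamma11_comp_cap.

End UpperTriangular.

Arguments UT K n : clear implicits.

(* Main.v *)
Require Import Defs.
From HB Require Import structures.
From mathcomp Require Import all_boot all_order all_algebra.
From mathcomp Require Import boolp classical_sets cardinality.
From mathcomp Require Import finmap ring.

(* Consider the words w_m = [[y_0, [y_1, ..., [y_(m-1), z]]], z].  On
   z = p e12 + q e23 and y_i acting on e12 and e23 by a_i and b_i, w_m takes
   the value p q (a_0 ... a_(m-1) + b_0 ... b_(m-1)) e13 up to sign, and in
   characteristic 2 these transfers are indecomposable in the ring of vector
   invariants of the swap a <-> b.  So w_(n+1) does not follow from the graded
   identities and from w_0, ..., w_n, and the T-ideals generated by
   w_0, ..., w_n modulo the identities form a strictly ascending chain.
   The independence is witnessed by Lie algebras V + R + K in which V acts on R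
   by commuting operators and R x R -> K is an alternating form with
   form (v f) g = - form f (v g): here R = K[x_0, ..., x_n]/(x_i^2), V is
   spanned by the x_i, and form f g is the coefficient of x_0 ... x_n in f g.
   Then w_m takes the value form (v_0 ... v_(m-1) f) f, which is 0 for m <= n
   since f^2 is a constant, and is not 0 for m = n + 1.  These algebras are
   graded subquotients of extensions of UT_3 by dual numbers, adjoined one at a
   time; such extensions preserve the identities because K is infinite. *)

Set Implicit Arguments.
Unset Strict Implicit.
Unset Printing Implicit Defensive.

Import GRing.Theory.

Local Open Scope classical_set_scope.
Local Open Scope ring_scope.

Section Char2.
Variables (K : fieldType) (V : lmodType K).
Hypothesis K_char2 : 2%N \in [pchar K].

Lemma addvv (v : V) : v + v = 0.
Proof. by rewrite -[v]scale1r -scalerDl addrr_pchar2 ?scale0r. Qed.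

End Char2.

(** * Polynomial maps with vector coefficients over an infinite field *)

Section VectorPolynomials.
Variables (K : fieldType) (V : lmodType K).
Hypothesis K_infinite : infinite_set [set: K].

Lemma uniq_seq_of_infinite n : exists2 s : seq K, uniq s & size s = n.
Proof.
have [B _ nB] := infinite_set_fset n K_infinite.
exists (take n (enum_fset B)); first by rewrite take_uniq ?fset_uniq.
by rewrite size_take; case: ltngtP nB.
Qed.

(** The [c j] form column [k] of the inverse of the Vandermonde matrix at distinct nodes [a j], so
    weighting values by them reads off the [k]-th coefficient of a polynomial of degree below
    [n]. *)
Lemma lagrange_functional n (k : 'I_n) : exists c a : 'I_n -> K,
  forall i : 'I_n, \sum_j c j * a j ^+ i = (i == k)%:R.
Proof.
have [s s_uniq s_size] := uniq_seq_of_infinite n.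
pose a := \row_(j < n) s`_j.
have V_unit : Vandermonde n a \in unitmx.
  rewrite unitmxE det_Vandermonde unitfE; apply/prodf_neq0 => i _.
  apply/prodf_neq0 => j ij; rewrite !mxE subr_eq0 nth_uniq ?s_size //.
  by rewrite gtn_eqF.
exists (fun j => (invmx (Vandermonde n a) *m delta_mx k (0 : 'I_1)) j 0).
exists (a 0) => i.
have := mulKVmx V_unit (delta_mx k (0 : 'I_1)).
move=> /(congr1 (fun M : 'cV_n => M i 0)).
rewrite [RHS]mxE eqxx andbT => <-; rewrite [RHS]mxE.
by apply: eq_bigr => j _; rewrite [X in _ = X * _]mxE mulrC.
Qed.

Fixpoint vhorner (s : seq V) (t : K) : V :=
  if s is v :: s' then v + t *: vhorner s' t else 0.

Lemma vhornerE s t : vhorner s t = \sum_(i < size s) t ^+ i *: s`_i.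
Proof.
elim: s => [|v s IH] /=; first by rewrite big_ord0.
rewrite big_ord_recl scale1r IH scaler_sumr; congr (_ + _).
by apply: eq_bigr => i _; rewrite scalerA -exprS.
Qed.

Lemma vhorner_eq0 s : (forall t, vhorner s t = 0) -> forall i, s`_i = 0.
Proof.
move=> s0 i; have [si|/(nth_default 0) //] := ltnP i (size s).
have [c [a ca]] := lagrange_functional (Ordinal si).
have : \sum_j c j *: vhorner s (a j) = 0.
  by apply: big1 => j _; rewrite s0 scaler0.
under eq_bigr => j _ do rewrite vhornerE scaler_sumr.
rewrite exchange_big /=.
under eq_bigr => j _ do (under eq_bigr => l _ do rewrite scalerA;
  rewrite -scaler_suml ca).
rewrite (bigD1 (Ordinal si)) //= eqxx scale1r big1 ?addr0 // => j /negPf ->.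
by rewrite scale0r.
Qed.

Definition vpoly (h : K -> V) := exists s, h =1 vhorner s.

Lemma vpoly0 : vpoly (fun=> 0). Proof. by exists [::]. Qed.

Lemma vpoly_cons v h : vpoly h -> vpoly (fun t => v + t *: h t).
Proof. by case=> s hs; exists (v :: s) => t /=; rewrite hs. Qed.

Lemma eq_vpoly g h : g =1 h -> vpoly g -> vpoly h.
Proof. by move=> gh [s gs]; exists s => t; rewrite -gh. Qed.

Lemma vpolyC v : vpoly (fun=> v).
Proof. by exists [:: v] => t /=; rewrite scaler0 addr0. Qed.

Lemma vpolyX h : vpoly h -> vpoly (fun t => t *: h t).
Proof. by move=> /(vpoly_cons 0); apply: eq_vpoly => t; rewrite add0r. Qed.

Lemma vpolyD g h : vpoly g -> vpoly h -> vpoly (fun t => g t + h t).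
Proof.
case=> s; elim: s g h => [|v s IH] g h gs.
  by apply: eq_vpoly => t; rewrite gs add0r.
case=> -[|w r] hr; first by exists (v :: s) => t; rewrite gs hr addr0.
have := IH (vhorner s) (vhorner r) (frefl _) (ex_intro _ r (frefl _)).
by move=> /(vpoly_cons (v + w)); apply: eq_vpoly => t;
  rewrite gs hr /= scalerDr addrACA.
Qed.

Lemma vpolyZ a h : vpoly h -> vpoly (fun t => a *: h t).
Proof.
case=> s; elim: s h => [|v s IH] h hs.
  by exists [::] => t; rewrite hs /= scaler0.
have := IH (vhorner s) (frefl _) => /(vpoly_cons (a *: v)).
by apply: eq_vpoly => t; rewrite hs /= scalerDr !scalerA mulrC.
Qed.

End VectorPolynomials.

Section LiePolynomials.
Variables (K : fieldType) (L : lieAlgType K).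

(** Induction on the Horner form of the left argument reduces to a constant left argument, for which
    the bracket acts coefficientwise. *)
Lemma vpoly_lie (g h : K -> L) :
  vpoly g -> vpoly h -> vpoly (fun t => lie (g t) (h t)).
Proof.
have lieC_poly u h' : vpoly h' -> vpoly (fun t => lie (u : L) (h' t)).
  case=> s; elim: s h' => [|v s IH] h' hs.
    by exists [::] => t; rewrite hs lieu0.
  have := IH (vhorner s) (frefl _) => /(vpoly_cons (lie u v)).
  by apply: eq_vpoly => t; rewrite hs /= lieDr lieZr.
move=> + hp; case=> s; elim: s g => [|v s IH] g gs.
  by exists [::] => t; rewrite gs lie0u.
have := IH (vhorner s) (frefl _) => /vpolyX /(vpolyD (lieC_poly v _ hp)).
by apply: eq_vpoly => t; rewrite gs /= lieDl lieZl.
Qed.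

End LiePolynomials.

(** * Graded homomorphisms and graded subquotients *)

Section Gradings.
Variables (K : pzRingType) (L : lieAlgType K) (G : z2_grading L).

Lemma gcompD g u v : G g u -> G g v -> G g (u + v).
Proof. by move=> gu gv; rewrite -[u]scale1r; apply: gcompZD. Qed.

Lemma gcompZ g a u : G g u -> G g (a *: u).
Proof.
by move=> gu; rewrite -[_ *: _]addr0; apply: gcompZD gu (gcomp0 G g).
Qed.

Lemma fl_lift_graded (f : gvar -> L) : (forall x, G (gvar_deg x) (f x)) ->
  graded_hom (free_grading K) G (@fl_lift K gvar L f).
Proof.
move=> fG; split=> [u v|g u]; first exact: fl_lift_lie.
elim=> {g u} [x|g|g a u v _ hu _ hv|g h u v _ hu _ hv].
- by rewrite /= fl_lift_gen.
- by rewrite linear0; apply: gcomp0.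
- by rewrite linearP; apply: gcompZD.
- by rewrite /= fl_lift_lie; apply: gcomp_lie.
Qed.

Lemma graded_hom_comp_gen (f : {linear freeLie K gvar -> L}) x :
  graded_hom (free_grading K) G f -> G (gvar_deg x) (f (fl_gen K x)).
Proof. by move=> /graded_hom_deg; apply; apply: free_comp_gen. Qed.

End Gradings.

(* A relation r as below is a homomorphism onto M from a graded subalgebra of
   L, so that M is a graded subquotient of L. *)
Lemma subquotient_identities (K : pzRingType) (L M : lieAlgType K)
    (G : z2_grading L) (H : z2_grading M) (r : L -> M -> Prop) :
  r 0 0 ->
  (forall a u v u' v', r u u' -> r v v' -> r (a *: u + v) (a *: u' + v')) ->
  (forall u v u' v', r u u' -> r v v' -> r (lie u v) (lie u' v')) ->
  (forall g u', H g u' -> exists2 u, G g u & r u u') ->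
  (forall u', r 0 u' -> u' = 0) ->
  graded_identities G `<=` graded_identities H.
Proof.
move=> r0 rZD rL r_onto r_fun w wG f fH.
(* Homogeneous preimages of the images of the variables define a graded homomorphism into [L] that
   stays [r]-related to [f]. *)
pose good x y := G (gvar_deg x) y /\ r y (f (fl_gen K x)).
have /(@boolp.choice _ _ good) [l lP] : forall x, exists y, good x y.
  move=> x; have [u Gu ru] := r_onto _ _ (graded_hom_comp_gen x fH).
  by exists u.
have rf u : r (@fl_lift K gvar L l u) (f u).
  elim/freeLie_ind: u => [x||u v hu hv|a u hu|u v hu hv].
  - by rewrite fl_lift_gen; have [] := lP x.
  - by rewrite !linear0.
  - by rewrite !linearD -[_ u]scale1r -[f u]scale1r; apply: rZD.
  - by rewrite !linearZ /= -[X in r X]addr0 -[X in r _ X]addr0; apply: rZD.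
  - by rewrite fl_lift_lie (graded_hom_lie fH); apply: rL.
have lG : graded_hom (free_grading K) G (@fl_lift K gvar L l).
  by apply: fl_lift_graded => x; have [] := lP x.
by apply: r_fun; rewrite -(wG _ lG); apply: rf.
Qed.

(** * Extension of scalars to the dual numbers *)

Section DualNumbers.
Variables (K : fieldType) (L : lieAlgType K) (G : z2_grading L).
Hypothesis K_char2 : 2%N \in [pchar K].

(* In characteristic 2 the group algebra K[s]/(s^2 - 1) is the algebra of dual
   numbers in e = s + 1, and x.1 + x.2 s = (x.1 + x.2) + x.2 e. *)
Definition dual_re (x : z2ext L) : L := x.1 + x.2.
Definition dual_im (x : z2ext L) : L := x.2.

Lemma dual_reZD a x y : dual_re (a *: x + y) = a *: dual_re x + dual_re y.
Proof. by rewrite /dual_re /= scalerDr addrACA. Qed.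

Lemma dual_imZD a x y : dual_im (a *: x + y) = a *: dual_im x + dual_im y.
Proof. by []. Qed.

Lemma dual_re_lie x y : dual_re (lie x y) = lie (dual_re x) (dual_re y).
Proof.
rewrite /dual_re /= !lieDl !lieDr.
by rewrite addrACA addrA -!addrA; do 2!congr (_ + _); rewrite addrC.
Qed.

(** This expresses e^2 = 0: the two copies of [lie x.2 y.2] cancel in characteristic 2. *)
Lemma dual_im_lie x y :
  dual_im (lie x y) = lie (dual_re x) (dual_im y) + lie (dual_im x) (dual_re y).
Proof.
rewrite /dual_re /dual_im /= lieDl lieDr [lie x.2 _ + lie _ _]addrC.
by rewrite -addrA (addrA (lie x.2 _)) addvv // add0r.
Qed.

Lemma dual_inj x y : dual_re x = dual_re y -> dual_im x = dual_im y -> x = y.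
Proof.
case: x y => [u u'] [v v']; rewrite /dual_re /dual_im /= => uv e.
by rewrite e in uv *; rewrite (addIr _ uv).
Qed.

Definition z2ext_comp (g : 'Z_2) : set (z2ext L) :=
  [set x | G g x.1 /\ G g x.2].

Lemma z2ext_comp0 g : z2ext_comp g 0.
Proof. by split; apply: gcomp0. Qed.

Lemma z2ext_compZD g a x y :
  z2ext_comp g x -> z2ext_comp g y -> z2ext_comp g (a *: x + y).
Proof. by case=> ? ? [? ?]; split; apply: gcompZD. Qed.

Lemma z2ext_comp_lie g h x y :
  z2ext_comp g x -> z2ext_comp h y -> z2ext_comp (g + h) (lie x y).
Proof.
by case=> ? ? [? ?]; split; apply: gcompD; apply: gcomp_lie.
Qed.

Lemma z2ext_comp_sum x :
  exists x0 x1, [/\ z2ext_comp 0 x0, z2ext_comp 1 x1 & x = x0 + x1].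
Proof.
case: x => u v.
have [u0 [u1 [? ? ->]]] := gcomp_sum G u.
have [v0 [v1 [? ? ->]]] := gcomp_sum G v.
by exists (u0, v0), (u1, v1).
Qed.

Lemma z2ext_comp_cap x : z2ext_comp 0 x -> z2ext_comp 1 x -> x = 0.
Proof.
by case: x => u v [/= ? ?] [/= ? ?]; congr pair; apply: (@gcomp_cap _ _ G).
Qed.

Definition z2ext_grading : z2_grading (z2ext L) :=
  Z2Grading z2ext_comp0 z2ext_compZD z2ext_comp_lie z2ext_comp_sum
    z2ext_comp_cap.

Hypothesis K_infinite : infinite_set [set: K].

Lemma z2ext_identities :
  graded_identities G `<=` graded_identities z2ext_grading.
Proof.
move=> w wG f fG.
(* Replacing e by a scalar [t] on the variables gives graded homomorphisms into [L]. The value at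
   [w] is polynomial in [t], with [dual_re (f w)] and [dual_im (f w)] as its two lowest
   coefficients; it vanishes for all [t], hence so do they. *)
pose ft t := @fl_lift K gvar L (fun x =>
  dual_re (f (fl_gen K x)) + t *: dual_im (f (fl_gen K x))).
have ftE u : exists2 h, vpoly h & forall t,
    ft t u = dual_re (f u) + t *: (dual_im (f u) + t *: h t).
  elim/freeLie_ind: u => [x||u v|a u|u v].
  - exists (fun=> 0); first exact: vpoly0.
    by move=> t; rewrite /ft fl_lift_gen scaler0 addr0.
  - exists (fun=> 0); first exact: vpoly0.
    by move=> t; rewrite /ft !linear0 /dual_re /dual_im /= !(scaler0, addr0).
  - move=> [g gp hg] [h hp hh]; exists (fun t => g t + h t).
      exact: vpolyD.
    move=> t; rewrite /ft !linearD /= [fl_lift _ u]hg [fl_lift _ v]hh.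
    rewrite /dual_re /dual_im /= !scalerDr addrACA.
    by congr (_ + _); rewrite addrACA.
  - move=> [h hp hh]; exists (fun t => a *: h t); first exact: vpolyZ.
    move=> t; rewrite /ft !linearZ /= [fl_lift _ u]hh !scalerDr !scalerA.
    by rewrite !(mulrC a) -!mulrA (mulrC a).
  - move=> [g gp hg] [h hp hh].
    rewrite (graded_hom_lie fG) dual_re_lie dual_im_lie.
    set a := dual_re (f u) in hg *; set b := dual_re (f v) in hh *.
    pose p t := dual_im (f u) + t *: g t; pose q t := dual_im (f v) + t *: h t.
    (* These are the terms divisible by t^2 in the expansion of [a + t p, b + t q], with t^2
       removed. *)
    exists (fun t => lie a (h t) + lie (g t) b + lie (p t) (q t)).
      by do 2?apply: vpolyD; apply: vpoly_lie => //;
        (exact: vpolyC || exact: vpoly_cons).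
    move=> t; rewrite /ft fl_lift_lie [fl_lift _ u]hg [fl_lift _ v]hh.
    have pE : dual_im (f u) + t *: g t = p t by [].
    have qE : dual_im (f v) + t *: h t = q t by [].
    rewrite pE qE; clearbody a b p q.
    rewrite lieDl !lieDr !lieZl !lieZr -!addrA; congr (_ + _).
    rewrite -[in lie a (q t)]qE -[in lie (p t) b]pE lieDl lieDr lieZl lieZr.
    rewrite !scalerDr.
    by rewrite (AC (2*(2*1)) (1*3*(2*4*5))) /= -!addrA.
have [h [s hs] hw] := ftE w.
have s0 t : vhorner [:: dual_re (f w), dual_im (f w) & s] t = 0.
  rewrite /= -hs -hw; apply: wG; apply: fl_lift_graded => x /=.
  have [? ?] := graded_hom_comp_gen x fG.
  by apply: gcompD; [apply: gcompD|apply: gcompZ].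
have re0 : dual_re (f w) = 0 := vhorner_eq0 K_infinite s0 0.
have im0 : dual_im (f w) = 0 := vhorner_eq0 K_infinite s0 1.
by apply: dual_inj; rewrite ?re0 ?im0 // /dual_re addr0.
Qed.

End DualNumbers.

(** * Commuting skew-adjoint operators and their Lie algebras *)

Record skew_module (K : fieldType) := SkewModule {
  op : lmodType K;
  vec : lmodType K;
  act : op -> vec -> vec;
  form : vec -> vec -> K;
  act_linearl : forall f, linear (act^~ f);
  act_linearr : forall v, linear (act v);
  actC : forall v w f, act v (act w f) = act w (act v f);
  form_linearl : forall g, scalar (form^~ g);
  form_linearr : forall f, scalar (form f);
  formxx : forall f, form f f = 0;
  form_act : forall v f g, form (act v f) g = - form f (act v g)
}.

Section SkewModuleTheory.
Variables (K : fieldType) (S : skew_module K).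
Implicit Types (v w : op S) (f g h : vec S).

Lemma actDl v w f : act (v + w) f = act v f + act w f.
Proof. by have := act_linearl f 1 v w; rewrite !scale1r. Qed.

Lemma actDr v f g : act v (f + g) = act v f + act v g.
Proof. by have := act_linearr v 1 f g; rewrite !scale1r. Qed.

Lemma act0l f : act (0 : op S) f = 0.
Proof. by apply: (addrI (act 0 f)); rewrite -actDl !addr0. Qed.

Lemma act0r v : act v (0 : vec S) = 0.
Proof. by apply: (addrI (act v 0)); rewrite -actDr !addr0. Qed.

Lemma actZl a v f : act (a *: v) f = a *: act v f.
Proof. by have := act_linearl f a v 0; rewrite !addr0 act0l addr0. Qed.

Lemma actZr a v f : act v (a *: f) = a *: act v f.
Proof. by have := act_linearr v a f 0; rewrite !addr0 act0r addr0. Qed.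

Lemma formDl f g h : form (f + g) h = form f h + form g h.
Proof. by have := form_linearl h 1 f g; rewrite scale1r mul1r. Qed.

Lemma formDr f g h : form h (f + g) = form h f + form h g.
Proof. by have := form_linearr h 1 f g; rewrite scale1r mul1r. Qed.

Lemma form0l f : form 0 f = 0.
Proof. by apply: (addrI (form 0 f)); rewrite -formDl !addr0. Qed.

Lemma form0r f : form f 0 = 0.
Proof. by apply: (addrI (form f 0)); rewrite -formDr !addr0. Qed.

Lemma formZl a f g : form (a *: f) g = a * form f g.
Proof. by have := form_linearl g a f 0; rewrite !addr0 form0l addr0. Qed.

Lemma formZr a f g : form f (a *: g) = a * form f g.
Proof. by have := form_linearr f a g 0; rewrite !addr0 form0r addr0. Qed.

Lemma formC f g : form f g = - form g f.
Proof.
apply/eqP; rewrite -addr_eq0 addrC; apply/eqP.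
by have := formxx (g + f); rewrite formDl !formDr !formxx add0r addr0.
Qed.

(** The last two factors form a Heisenberg algebra with centre [K^o], on which the abelian algebra
    [op S] acts by derivations. *)
Definition heis := (op S * vec S * K^o)%type.
HB.instance Definition _ := GRing.Lmodule.on heis.

Definition heis_lie (x y : heis) : heis :=
  (0, act x.1.1 y.1.2 - act y.1.1 x.1.2, form x.1.2 y.1.2).

Lemma heis_lie_linearl z : linear (heis_lie^~ z).
Proof.
move=> a x y; rewrite /heis_lie; congr (_, _, _).
- by rewrite /= scaler0 addr0.
- by rewrite /= actDl actDr actZl actZr opprD addrACA scalerBr.
- by rewrite /= formDl formZl.
Qed.

Lemma heis_lie_linearr z : linear (heis_lie z).
Proof.
move=> a x y; rewrite /heis_lie; congr (_, _, _).
- by rewrite /= scaler0 addr0.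
- by rewrite /= actDl actDr actZl actZr opprD addrACA scalerBr.
- by rewrite /= formDr formZr.
Qed.

Lemma heis_liexx x : heis_lie x x = 0.
Proof. by rewrite /heis_lie formxx subrr. Qed.

(** The vector component vanishes because operators commute. In the central one, [form f (act v h)]
    is symmetric in [f] and [h], so the six terms cancel in pairs. *)
Lemma heis_jacobi x y z :
  heis_lie x (heis_lie y z) + heis_lie y (heis_lie z x)
    + heis_lie z (heis_lie x y) = 0.
Proof.
case: x y z => [[u f] a] [[v g] b] [[w h] c]; rewrite /heis_lie.
congr (_, _, _); rewrite /= ?addr0 //.
- rewrite !act0l !subr0 !actDr -!scaleN1r !actZr !scaleN1r.
  rewrite (actC v u) (actC w u) (actC w v).
  by rewrite (AC (2*2*2) (1*4*(3*6)*(5*2))) /= !subrr !addr0.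
- rewrite !formDr -!scaleN1r !formZr !mulN1r.
  rewrite (formC f (act w g)) (formC g (act u h)) (formC h (act v f)).
  rewrite !form_act !opprK.
  by rewrite !subrKA subrr.
Qed.

HB.instance Definition _ := Lmodule_isLieAlgebra.Build K heis
  heis_lie_linearl heis_lie_linearr heis_liexx heis_jacobi.

(** Degrees imitate [Gamma11]: operators play the diagonal, the centre plays e13, and vectors play
    e12 and e23. *)
Definition heis_comp (d : 'Z_2) : set heis :=
  [set x | if d == 0 then x.1.2 = 0 else x.1.1 = 0 /\ x.2 = 0].

Lemma heis_comp0 d : heis_comp d 0.
Proof. by rewrite /heis_comp /=; case: ifP. Qed.

Lemma heis_compZD d a x y :
  heis_comp d x -> heis_comp d y -> heis_comp d (a *: x + y).
Proof.
rewrite /heis_comp /=; case: ifP => _ => [-> ->|[-> ->] [-> ->]];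
  by rewrite !scaler0 !addr0.
Qed.

Lemma z2P (d : 'Z_2) : d = 0 \/ d = 1.
Proof. by case: d => [[|[|//]] lt_g]; [left|right]; apply: val_inj. Qed.

Lemma heis_comp_lie d e x y :
  heis_comp d x -> heis_comp e y -> heis_comp (d + e) (lie x y).
Proof.
rewrite /heis_comp.
case: (z2P d) => ->; case: (z2P e) => -> /=.
- by move=> -> ->; rewrite !act0r subrr.
- by move=> -> _; rewrite form0l.
- by move=> _ ->; rewrite form0r.
- by move=> [-> _] [-> _]; rewrite !act0l subrr.
Qed.

Lemma heis_comp_sum x :
  exists x0 x1, [/\ heis_comp 0 x0, heis_comp 1 x1 & x = x0 + x1].
Proof.
case: x => [[v f] a]; exists (v, 0, a), (0, f, 0); split=> //.
by congr (_, _, _); rewrite /= ?addr0 ?add0r.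
Qed.

Lemma heis_comp_cap x : heis_comp 0 x -> heis_comp 1 x -> x = 0.
Proof. by case: x => [[v f] a]; rewrite /heis_comp /= => -> [-> ->]. Qed.

Definition heis_grading : z2_grading heis :=
  Z2Grading heis_comp0 heis_compZD heis_comp_lie heis_comp_sum
    heis_comp_cap.

End SkewModuleTheory.

(** * Adjoining scalars and dual numbers to a skew module *)

Section Constructions.
Variable K : fieldType.
Hypothesis K_char2 : 2%N \in [pchar K].
Variable S : skew_module K.

(* Once the scalars act, so does e times the identity over the dual numbers:
   this is the operator that dual_ext adds. *)
Definition scalar_op := (K^o * op S)%type.
HB.instance Definition _ := GRing.Lmodule.on scalar_op.

Definition scalar_act (p : scalar_op) (f : vec S) : vec S :=
  p.1 *: f + act p.2 f.

Fact scalar_act_linearl f : linear (scalar_act^~ f).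
Proof.
move=> a p q; rewrite /scalar_act /= scalerDl actDl actZl scalerDr scalerA.
exact: addrACA.
Qed.

Fact scalar_act_linearr p : linear (scalar_act p).
Proof.
move=> a f g; rewrite /scalar_act actDr actZr !scalerDr !scalerA mulrC.
exact: addrACA.
Qed.

Fact scalar_actC p q f :
  scalar_act p (scalar_act q f) = scalar_act q (scalar_act p f).
Proof.
rewrite /scalar_act !actDr !actZr !scalerDr !scalerA actC [q.1 * _]mulrC.
by rewrite (AC (2*2) ((1*3)*(2*4))).
Qed.

(** Scalars are self-adjoint, which in characteristic 2 is the same as skew-adjoint. *)
Fact scalar_form_act p f g :
  form (scalar_act p f) g = - form f (scalar_act p g).
Proof.
rewrite /scalar_act formDl formDr formZl formZr form_act opprD.
by rewrite (oppr_pchar2 K_char2 (_ * _)).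
Qed.

Definition scalar_ext : skew_module K :=
  SkewModule scalar_act_linearl scalar_act_linearr scalar_actC
    (@form_linearl K S) (@form_linearr K S) (@formxx K S) scalar_form_act.

(* (f, g) stands for f + g e and (v, b) for v + b e, where e^2 = 0; the form is
   the coefficient of e. *)
Definition dual_op := (op S * K^o)%type.
HB.instance Definition _ := GRing.Lmodule.on dual_op.
Definition dual_vec := (vec S * vec S)%type.
HB.instance Definition _ := GRing.Lmodule.on dual_vec.

Definition dual_act (p : dual_op) (f : dual_vec) : dual_vec :=
  (act p.1 f.1, act p.1 f.2 + p.2 *: f.1).

Definition dual_form (f g : dual_vec) : K := form f.1 g.2 + form f.2 g.1.

Fact dual_act_linearl f : linear (dual_act^~ f).
Proof.
move=> a p q; rewrite /dual_act; congr pair; rewrite /= !actDl !actZl //.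
by rewrite scalerDl scalerDr scalerA addrACA.
Qed.

Fact dual_act_linearr p : linear (dual_act p).
Proof.
move=> a f g; rewrite /dual_act; congr pair; rewrite /= !actDr !actZr //.
by rewrite !scalerDr !scalerA mulrC addrACA.
Qed.

Fact dual_actC p q f : dual_act p (dual_act q f) = dual_act q (dual_act p f).
Proof.
rewrite /dual_act /=; congr pair; first exact: actC.
by rewrite !actDr !actZr -!addrA actC; congr (_ + _); rewrite addrC.
Qed.

Fact dual_form_linearl g : scalar (dual_form^~ g).
Proof.
by move=> a f h; rewrite /dual_form /= !formDl !formZl mulrDr addrACA.
Qed.

Fact dual_form_linearr f : scalar (dual_form f).
Proof.
by move=> a g h; rewrite /dual_form /= !formDr !formZr mulrDr addrACA.
Qed.

Fact dual_formxx f : dual_form f f = 0.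
Proof. by rewrite /dual_form formC addNr. Qed.

Fact dual_form_act p f g :
  dual_form (dual_act p f) g = - dual_form f (dual_act p g).
Proof.
rewrite /dual_form /= !formDl !formDr !formZl !formZr !form_act.
rewrite !opprD -!addrA (oppr_pchar2 K_char2 (_ * _)).
by congr (_ + _); rewrite addrC.
Qed.

Definition dual_ext : skew_module K :=
  SkewModule dual_act_linearl dual_act_linearr dual_actC dual_form_linearl
    dual_form_linearr dual_formxx dual_form_act.

End Constructions.

(** * The bottom of the tower *)

Section Plane.
Variable K : fieldType.
Hypothesis K_char2 : 2%N \in [pchar K].

(* dual_ext of the line K with the form f g, which itself is not alternating. *)
Definition plane := (K^o * K^o)%type.
HB.instance Definition _ := GRing.Lmodule.on plane.

Definition plane_act (b : K^o) (f : plane) : plane := (0, b * f.1).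

Definition plane_form (f g : plane) : K := f.1 * g.2 + f.2 * g.1.

Fact plane_act_linearl f : linear (plane_act^~ f).
Proof.
move=> a b c; congr pair; first by rewrite /= scaler0 addr0.
by rewrite /= mulrDl -mulrA.
Qed.

Fact plane_act_linearr b : linear (plane_act b).
Proof.
move=> a f g; congr pair; first by rewrite /= scaler0 addr0.
by rewrite /= mulrDr /GRing.scale /= mulrCA.
Qed.

Fact plane_actC b c f :
  plane_act b (plane_act c f) = plane_act c (plane_act b f).
Proof. by rewrite /plane_act /= !mulr0. Qed.

Fact plane_form_linearl g : scalar (plane_form^~ g).
Proof. by move=> a f h; rewrite /plane_form /= /GRing.scale /=; ring. Qed.

Fact plane_form_linearr f : scalar (plane_form f).
Proof. by move=> a g h; rewrite /plane_form /= /GRing.scale /=; ring. Qed.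

Fact plane_formxx f : plane_form f f = 0.
Proof. by rewrite /plane_form mulrC addrr_pchar2. Qed.

Fact plane_form_act b f g :
  plane_form (plane_act b f) g = - plane_form f (plane_act b g).
Proof. rewrite oppr_pchar2 // /plane_form /=; ring. Qed.

Definition plane_module : skew_module K :=
  SkewModule plane_act_linearl plane_act_linearr plane_actC plane_form_linearl
    plane_form_linearr plane_formxx plane_form_act.

End Plane.

Arguments act : simpl never.
Arguments form : simpl never.

(** * Identities survive the two extensions *)

Section Identities.
Variables (K : fieldType).
Hypothesis K_infinite : infinite_set [set: K].
Hypothesis K_char2 : 2%N \in [pchar K].

Lemma scalar_ext_act (S : skew_module K) (p : op (scalar_ext K_char2 S)) f :
  act p f = p.1 *: f + act p.2 f.
Proof. by []. Qed.

Lemma dual_ext_act (S : skew_module K) (p : op (dual_ext K_char2 S)) f :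
  act p f = (act p.1 f.1, act p.1 f.2 + p.2 *: f.1).
Proof. by []. Qed.

Lemma dual_ext_form (S : skew_module K) (f g : vec (dual_ext K_char2 S)) :
  form f g = form f.1 g.2 + form f.2 g.1.
Proof. by []. Qed.

(** [heis S] is the subalgebra of elements whose operator has scalar part 0. *)
Lemma heis_scalar_ext_identities (S : skew_module K) :
  graded_identities (heis_grading (scalar_ext K_char2 S))
    `<=` graded_identities (heis_grading S).
Proof.
apply: (subquotient_identities
  (r := fun (x : heis (scalar_ext K_char2 S)) (y : heis S) =>
    [/\ x.1.1 = (0, y.1.1), x.1.2 = y.1.2 & x.2 = y.2])) => //.
- move=> a [[p f] s] [[q g] t] [[v f'] s'] [[w g'] t'] /= [-> -> ->] [-> -> ->].
  by split=> //; congr pair; rewrite /= scaler0 addr0.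
- move=> [[p f] s] [[q g] t] [[v f'] s'] [[w g'] t'] /= [-> -> _] [-> -> _].
  by split=> //; rewrite /act /= /scalar_act /= !scale0r !add0r.
- move=> d [[v f] s] H; exists ((0, v), f, s) => //.
  by move: H; rewrite /= /heis_comp /=; case: ifP => // _ [-> ->].
- by move=> [[v f] s] [/= [<-] <- <-].
Qed.

(** Over the dual numbers, keep the elements whose operator has a pure scalar [b] as its e-part, and
    forget the real central component. Then [b] e is the new operator, and the e-part of the centre
    receives [dual_form]. *)
Lemma heis_dual_ext_identities (S : skew_module K) :
  graded_identities (heis_grading (scalar_ext K_char2 S))
    `<=` graded_identities
           (heis_grading (scalar_ext K_char2 (dual_ext K_char2 S))).
Proof.
apply: subset_trans (z2ext_identities K_char2 (G := _) K_infinite) _.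
pose S' := scalar_ext K_char2 S.
pose T := scalar_ext K_char2 (dual_ext K_char2 S).
apply: (subquotient_identities (r := fun (x : z2ext (heis S')) (y : heis T) =>
  [/\ (dual_re x).1 = ((y.1.1.1, y.1.1.2.1), y.1.2.1) &
      dual_im x = ((y.1.1.2.2, 0), y.1.2.2, y.2)])) => //.
- by rewrite /dual_re /= !addr0.
- move=> a x y x' y'; rewrite dual_reZD dual_imZD /= => -[-> ->] [-> ->].
  split=> //; congr (_, _, _); congr (_, _).
  by rewrite /= scaler0 addr0.
- move=> x y x' y'; rewrite dual_re_lie dual_im_lie //.
  case: (dual_re x) (dual_re y) => [f s] [g t] /= [-> ->] [-> ->].
  split; first by [].
  rewrite -[lie _ _ + _]/(_, _, _); congr (_, _, _).
  + by rewrite /= addr0.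
  + rewrite /= !scalar_ext_act /= !act0l !addr0 !opprD.
    rewrite (AC (3*(1*2)) ((1*(2*4))*(5*(6*3)))) /=.
    by congr (_ + (_ + _) + (_ + (_ - _))).
- move=> d [[[a [v b]] [f g]] s] H.
  (* The first component is the real part minus the e-part; the free real centre is set to 0. *)
  exists ((a - b, v, f - g, - s), (b, 0, g, s)).
  + move: H; rewrite /= /z2ext_comp /= /heis_comp /=.
    case: ifP => _ [].
      by move=> -> ->; rewrite subrr.
    by move=> [-> -> ->] ->; rewrite subrr oppr0.
  + rewrite /dual_re /dual_im; split=> //.
    by congr (_, _, _); rewrite /= ?addr0 ?subrK.
- move=> [[[a [v b]] [f g]] s] []; rewrite /dual_re /dual_im /= !addr0.
  by case=> <- <- <- [<- <- <-].
Qed.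

End Identities.

(** * Coordinates on upper triangular matrices with zero e11 entry *)

Section UpperTriangular3.
Variable K : fieldType.

(* Entries d2, d3, p, q, s stand at e22, e33, e12, e23, e13. *)
Definition ut3_mx (d2 d3 p q s : K) : 'M[K]_3 :=
  \matrix_(i < 3, j < 3)
    nth 0 (nth [::] [:: [:: 0; p; s]; [:: 0; d2; q]; [:: 0; 0; d3]] i) j.

Fact ut3_subproof d2 d3 p q s : ut3_mx d2 d3 p q s \in @upper_trig_mx K 3.
Proof.
by apply/upper_trig_mxP => -[[|[|[|//]]] ?] [[|[|[|//]]] ?] //=; rewrite mxE.
Qed.

Definition ut3 d2 d3 p q s : UT K 3 := MkUT (ut3_subproof d2 d3 p q s).

Lemma ut3ZD a d2 d3 p q s d2' d3' p' q' s' :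
  a *: ut3 d2 d3 p q s + ut3 d2' d3' p' q' s' =
  ut3 (a * d2 + d2') (a * d3 + d3') (a * p + p') (a * q + q') (a * s + s').
Proof.
apply/val_inj/matrixP => -[[|[|[|//]]] ?] [[|[|[|//]]] ?];
  by rewrite !mxE //= ?mulr0 ?addr0.
Qed.

Lemma ut3D d2 d3 p q s d2' d3' p' q' s' :
  ut3 d2 d3 p q s + ut3 d2' d3' p' q' s' =
  ut3 (d2 + d2') (d3 + d3') (p + p') (q + q') (s + s').
Proof. by rewrite -[X in X + _]scale1r ut3ZD !mul1r. Qed.

Lemma ut3_lie d2 d3 p q s d2' d3' p' q' s' :
  lie (ut3 d2 d3 p q s) (ut3 d2' d3' p' q' s') =
  ut3 0 0 (p * d2' - p' * d2) (d2 * q' + q * d3' - d2' * q - q' * d3)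
    (p * q' - p' * q + s * d3' - s' * d3).
Proof.
apply/val_inj/matrixP => -[[|[|[|//]]] ?] [[|[|[|//]]] ?];
  rewrite !mxE !big_ord_recl !big_ord0 !mxE /=; ring.
Qed.

Lemma ut3_inj d2 d3 p q s d2' d3' p' q' s' :
  ut3 d2 d3 p q s = ut3 d2' d3' p' q' s' ->
  [/\ d2 = d2', d3 = d3', p = p', q = q' & s = s'].
Proof.
move=> /(congr1 (@ut_val K 3)) /matrixP e.
by split; [have := e 1 1|have := e 2 2|have := e 0 1|have := e 1 2
  |have := e 0 2]; rewrite !mxE.
Qed.

Lemma ut3_0 : ut3 0 0 0 0 0 = 0.
Proof.
by apply/val_inj/matrixP => -[[|[|[|//]]] ?] [[|[|[|//]]] ?]; rewrite !mxE.
Qed.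

Lemma ut3_deg0 d2 d3 s : Gamma11_comp 0 (ut3 d2 d3 0 0 s).
Proof.
move=> -[[|[|[|//]]] ?] [[|[|[|//]]] ?]; rewrite mxE /= ?eqxx // => _;
  exact: val_inj.
Qed.

Lemma ut3_deg1 p q : Gamma11_comp 1 (ut3 0 0 p q 0).
Proof.
move=> -[[|[|[|//]]] ?] [[|[|[|//]]] ?]; rewrite mxE /= ?eqxx // => _;
  exact: val_inj.
Qed.

End UpperTriangular3.

(** * The bottom of the tower as a subquotient of UT_3 over the dual numbers *)

Section Base.
Variables (K : fieldType).
Hypothesis K_infinite : infinite_set [set: K].
Hypothesis K_char2 : 2%N \in [pchar K].

(** The vectors (1, 0) and (0, 1) come from e12 + e23 and e12 e. Up to sign, e22 acts on both as the
    identity, (e22 + e33) e sends the first to the second, and their bracket is e13 e, which is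
    central here. *)
Lemma heis_plane_identities :
  graded_identities (Gamma11 K) `<=`
  graded_identities (heis_grading (scalar_ext K_char2 (plane_module K_char2))).
Proof.
apply: subset_trans (z2ext_identities K_char2 (G := _) K_infinite) _.
pose T := scalar_ext K_char2 (plane_module K_char2).
apply: (subquotient_identities (r := fun (x : z2ext (UT K 3)) (y : heis T) =>
  [/\ dual_re x = @ut3 K y.1.1.1 0 y.1.2.1 y.1.2.1 0 &
      dual_im x = @ut3 K y.1.1.2 y.1.1.2 y.1.2.2 0 y.2])).
- by rewrite ut3_0 /dual_re addr0.
- move=> a x y x' y'; rewrite dual_reZD dual_imZD => -[-> ->] [-> ->].
  by rewrite !ut3ZD !mulr0 !addr0.
- move=> x y x' y'; rewrite dual_re_lie dual_im_lie // => -[-> ->] [-> ->].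
  case: x' y' => [[[a b] [f g]] s] [[[a' b'] [f' g']] s'].
  have formE : @form _ T (f, g) (f', g') = f * g' + g * f' by [].
  rewrite !ut3_lie ut3D /=; split; congr (ut3 _ _ _ _ _);
    rewrite /= ?formE /GRing.scale /=; try ring;
    by rewrite !(oppr_pchar2 K_char2); ring.
- move=> d [[[a b] [f g]] s] H.
  exists (@ut3 K a 0 f f 0 - @ut3 K b b g 0 s, @ut3 K b b g 0 s).
    have [dre dim] :
        Gamma11 K d (@ut3 K a 0 f f 0) /\ Gamma11 K d (@ut3 K b b g 0 s).
      move: H; case: (z2P d) => -> /=; rewrite /heis_comp /=.
        by case=> -> ->; split; apply: ut3_deg0.
      by case=> -[-> ->] ->; split; apply: ut3_deg1.
    by split=> //=; rewrite addrC -scaleN1r; apply: (gcompZD (z := Gamma11 K)).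
  by rewrite /dual_re /dual_im /= subrK.
- move=> [[[a b] [f g]] s] []; rewrite /dual_re /dual_im /= addr0 -ut3_0.
  by move=> /ut3_inj[] /= <- _ <- _ _ /ut3_inj [<- _ <- _ <-].
Qed.
End Base.

(** * The first word that does not vanish on each level of the tower *)

Section Nilpotency.
Variable K : fieldType.

Definition act_seq (S : skew_module K) (vs : seq (op S)) (f : vec S) : vec S :=
  foldr (@act K S) f vs.

(* The word w_n is the first one that is not an identity of heis S. *)
Definition has_degree (S : skew_module K) (n : nat) :=
  (forall vs (f : vec S), (size vs < n)%N -> form (act_seq vs f) f = 0) /\
  exists2 vs, size vs = n & exists f : vec S, form (act_seq vs f) f != 0.

Hypothesis K_char2 : 2%N \in [pchar K].

Lemma plane_has_degree : has_degree (plane_module K_char2) 1.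
Proof.
split=> [[|//] f _|]; first exact: formxx.
exists [:: 1 : K^o] => //; exists (1, 0).
by rewrite /form /= /plane_form /= !mul0r add0r !mul1r oner_neq0.
Qed.

(** Without signs the form is symmetric and each operator self-adjoint; commutativity restores the
    order after all are moved across. *)
Lemma form_act_seq (S : skew_module K) vs (f g : vec S) :
  form (act_seq vs f) g = form (act_seq vs g) f.
Proof.
have seqC v ws h : act v (act_seq ws h) = act_seq ws (act v h) :> vec S.
  by elim: ws => //= w ws <-; apply: actC.
rewrite formC (oppr_pchar2 K_char2).
elim: vs f g => [|v vs IH] f g //=.
by rewrite -(oppr_pchar2 K_char2 (form g _)) -form_act IH seqC.
Qed.

Lemma act_seqD (S : skew_module K) vs (f g : vec S) :
  act_seq vs (f + g) = act_seq vs f + act_seq vs g.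
Proof. by elim: vs => //= v vs ->; rewrite actDr. Qed.

Lemma act_seqZ (S : skew_module K) vs a (f : vec S) :
  act_seq vs (a *: f) = a *: act_seq vs f.
Proof. by elim: vs => //= v vs ->; rewrite actZr. Qed.

(** Here [h] is the sum over i of the e-part of the i-th operator times the product of the other
    first components applied to [f]. One operator is lost, so its pairings with [f] involve words
    shorter than [n]. The prefix [ws] absorbs [v.1] in the induction. *)
Lemma dual_act_seq (S : skew_module K) n (f g : vec S)
    (vs : seq (op (dual_ext K_char2 S))) : has_degree S n ->
  exists h, act_seq vs ((f, g) : vec (dual_ext K_char2 S)) =
      (act_seq (unzip1 vs) f, act_seq (unzip1 vs) g + h) /\
    forall ws, (size ws + size vs <= n)%N -> form (act_seq ws h) f = 0.
Proof.
move=> [Sn _]; elim: vs => [|v vs [h [vsE hn]]] /=.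
  exists 0; split=> [|ws _]; first by rewrite addr0.
  by rewrite -(scale0r f) act_seqZ scale0r form0l.
exists (act v.1 h + v.2 *: act_seq (unzip1 vs) f); split.
  by rewrite vsE dual_ext_act /= actDr addrA.
move=> ws; rewrite addnS => lt_n; rewrite act_seqD act_seqZ formDl formZl.
have := hn (rcons ws v.1); rewrite size_rcons addSn /act_seq foldr_rcons.
move=> -> //; rewrite -foldr_cat Sn ?mulr0 ?addr0 //.
by rewrite size_cat size_map.
Qed.

Lemma dual_ext_has_degree (S : skew_module K) n :
  has_degree S n -> has_degree (dual_ext K_char2 S) n.+1.
Proof.
move=> Sn; split=> [vs [f g] vs_n|].
  have [h [-> hn]] := dual_act_seq f g vs Sn.
  (* By symmetry the two terms pairing [f] with [g] coincide and cancel in characteristic 2, leaving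
     only [form h f]. *)
  rewrite dual_ext_form /= formDl form_act_seq.
  by rewrite (hn [::]) // addr0 addrr_pchar2.
have [vs vs_n [f f_n0]] := Sn.2.
(* The extra operator is e itself: it moves [form (act_seq vs f) f] into the coefficient of e, which
   the new form reads. *)
exists ((0, 1 : K^o) :: [seq (v, 0 : K^o) | v <- vs]).
  by rewrite /= size_map vs_n.
have vsE : act_seq [seq (v, 0) : op (dual_ext K_char2 S) | v <- vs]
    ((f, 0) : vec (dual_ext K_char2 S)) = (act_seq vs f, 0).
  elim: vs {vs_n f_n0} => //= v vs ->.
  by rewrite dual_ext_act /= act0r scale0r addr0.
exists (f, 0); rewrite /= vsE.
by rewrite /= dual_ext_act dual_ext_form /= !act0l !add0r form0r add0r scale1r.
Qed.

(** Each level adjoins one square-zero variable, so level [n] has the n + 1 variables x_0, ...,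
    x_n. *)
Fixpoint skew_tower n : skew_module K :=
  if n is m.+1 then dual_ext K_char2 (skew_tower m) else plane_module K_char2.

Lemma skew_tower_has_degree n : has_degree (skew_tower n) n.+1.
Proof.
elim: n => [|n IH]; first exact: plane_has_degree.
exact: dual_ext_has_degree.
Qed.

Hypothesis K_infinite : infinite_set [set: K].

Lemma skew_tower_identities n :
  graded_identities (Gamma11 K) `<=`
  graded_identities (heis_grading (skew_tower n)).
Proof.
(* The induction carries the adjoined scalars, which every dual step needs; they are dropped only at
   the end. *)
refine (subset_trans _ (@heis_scalar_ext_identities _ K_char2 (skew_tower n))).
elim: n => [|n IH]; first exact: heis_plane_identities.
apply: subset_trans IH _.
exact: (@heis_dual_ext_identities _ K_infinite K_char2 (skew_tower n)).
Qed.

(** * Values of the words w_m *)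

Local Notation L := (freeLie K gvar).

Definition yvars m : seq L := [seq fl_gen K (yvar i) | i <- iota 0 m].

Definition zyz_word m : L :=
  lie (foldr (@lie K L) (fl_gen K (zvar 0)) (yvars m)) (fl_gen K (zvar 0)).

Lemma lie_foldr_heis (S : skew_module K) (xs : seq (heis S)) (f : vec S) :
  (forall x, x \in xs -> x.1.2 = 0) ->
  foldr lie ((0, f, 0) : heis S) xs = (0, act_seq [seq x.1.1 | x <- xs] f, 0).
Proof.
elim: xs => //= x xs IH xs0.
rewrite IH => [|y y_xs]; last by rewrite xs0 // inE y_xs orbT.
by congr (_, _, _); rewrite /= ?act0l ?subr0 // xs0 ?mem_head // form0l.
Qed.

(** By degree, z maps to a pure vector and each y_i has no vector component, so bracketing with y_i
    just applies its operator. *)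
Lemma zyz_word_hom (S : skew_module K) (phi : {linear L -> heis S}) m :
  graded_hom (free_grading K) (heis_grading S) phi ->
  phi (zyz_word m) =
    let f := (phi (fl_gen K (zvar 0))).1.2 in
    (0, 0, form (act_seq [seq (phi x).1.1 | x <- yvars m] f) f).
Proof.
move=> phiG; rewrite /zyz_word (graded_hom_lie phiG).
have morph x xs : phi (foldr lie x xs) = foldr lie (phi x) (map phi xs).
  by elim: xs => //= y ys <-; rewrite (graded_hom_lie phiG).
have := graded_hom_comp_gen (zvar 0) phiG; rewrite morph.
case: (phi (fl_gen K (zvar 0))) => [[v f] s].
rewrite /= /heis_comp /= => -[-> ->].
rewrite lie_foldr_heis => [|x]; last first.
  rewrite /yvars -map_comp => /mapP [i _ ->] /=.
  exact: (graded_hom_comp_gen (yvar i) phiG).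
by rewrite -map_comp; congr (_, _, _); rewrite /= !act0l subrr.
Qed.

Lemma zyz_word_identity (S : skew_module K) n m :
  has_degree S n -> (m < n)%N ->
  graded_identities (heis_grading S) (zyz_word m).
Proof.
move=> [Sn _] mn phi phiG; rewrite zyz_word_hom //= Sn //.
by rewrite !size_map size_iota.
Qed.

Lemma zyz_word_nonidentity (S : skew_module K) n :
  has_degree S n -> ~ graded_identities (heis_grading S) (zyz_word n).
Proof.
move=> [_ [vs vs_n [f /eqP f_n0]]] word0.
(* The default 0 of [nth] only affects variables y_i with i >= n, which do not occur in the word. *)
pose phi := @fl_lift K gvar (heis S) (fun x =>
  match x with yvar i => (vs`_i, 0, 0) | zvar _ => (0, f, 0) end).
have phiG : graded_hom (free_grading K) (heis_grading S) phi.
  by apply: fl_lift_graded => -[].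
apply: f_n0; move: (word0 _ phiG).
rewrite zyz_word_hom //= fl_lift_gen /= => -[].
congr (form (act_seq _ f) f = 0).
rewrite /yvars -map_comp -vs_n; under eq_map do rewrite /= fl_lift_gen /=.
exact: mkseq_nth.
Qed.

End Nilpotency.

(** * Ascending chains of T-ideals and the conclusion *)

Section TIdealChains.
Variable K : pzRingType.
Local Notation L := (freeLie K gvar).

Lemma smallest_T_ideal (G : set L) : T_ideal (smallest (@T_ideal K) G).
Proof.
split=> [|a u v hu hv|u v hv|f hf u hu] J [JT GJ].
- exact: T_ideal0.
- by apply: T_idealZD => //; [apply: hu|apply: hv].
- by apply: T_ideal_lie => //; apply: hv.
- by apply: (T_ideal_end JT hf); apply: hu.
Qed.

Lemma bigcup_T_ideal (J : nat -> set L) :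
  (forall n, T_ideal (J n)) -> (forall m n, (m <= n)%N -> J m `<=` J n) ->
  T_ideal (\bigcup_n J n).
Proof.
move=> JT J_mono; split.
- by exists 0%N => //; apply: T_ideal0.
- move=> a u v [m _ mu] [n _ nv]; exists (maxn m n) => //.
  apply: T_idealZD => //.
    exact: J_mono (leq_maxl m n) _ mu.
  exact: J_mono (leq_maxr m n) _ nv.
- by move=> u v [n _ nv]; exists n => //; apply: T_ideal_lie.
- by move=> f hf u [n _ nu]; exists n => //; apply: (T_ideal_end (JT n) hf).
Qed.

(** The union of the chain is a T-ideal containing [I], and its finitely many generators already lie
    in one term. *)
Lemma specht_chain (I : set L) (J : nat -> set L) : specht_property I ->
  (forall n, T_ideal (J n)) -> (forall m n, (m <= n)%N -> J m `<=` J n) ->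
  I `<=` J 0 -> exists n, forall m, J m `<=` J n.
Proof.
move=> spI JT J_mono IJ.
have [|S S_fin JS] := spI _ (bigcup_T_ideal JT J_mono).
  by move=> u /IJ; exists 0%N.
have [n Sn] : exists n, S `<=` J n.
  have : S `<=` \bigcup_n J n by rewrite JS; apply: sub_gen_smallest.
  have /finite_seqP[s ->] := S_fin.
  elim: s => [|u s IH] sJ; first by exists 0%N => u.
  have [n sn] : exists n, [set` s] `<=` J n.
    by apply: IH => v vs; apply: sJ; rewrite /= inE vs orbT.
  have [|m _ um] := sJ u; first by rewrite /= mem_head.
  exists (maxn n m) => v /=; rewrite inE => /orP[/eqP ->|/sn].
    exact: J_mono (leq_maxr n m) _ um.
  exact: J_mono (leq_maxl n m) _.
exists n => m u mu.
have : (\bigcup_n J n) u by exists m.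
by rewrite JS; apply: smallest_sub.
Qed.

End TIdealChains.

Theorem proposition3p25 (K : fieldType)
    (K_infinite : infinite_set [set: K]) (K_char2 : 2%N \in [pchar K]) :
  ~ specht_property (graded_identities (Gamma11 K)).
Proof.
move=> spI; pose I := graded_identities (Gamma11 K).
pose G n := I `|` [set zyz_word K m | m in [set m | m <= n]%N].
pose J n := smallest (@T_ideal K) (G n).
have J_mono m n : (m <= n)%N -> J m `<=` J n.
  move=> mn; apply: smallest_sub; first exact: smallest_T_ideal.
  move=> u Gu; apply: sub_gen_smallest.
  case: Gu => [Iu|[k /= km <-]]; [by left|right].
  by exists k => //=; apply: leq_trans mn.
have [|n Jn] := specht_chain spI (fun n => @smallest_T_ideal K (G n)) J_mono.
  by move=> u Iu; apply: sub_gen_smallest; left.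
(* If the chain stopped at [n], then w_(n+1) would lie in [J n], hence be an identity of level [n]
   of the tower, whose degree is n + 1. *)
apply: (zyz_word_nonidentity (skew_tower_has_degree K_char2 n)).
have JI : J n `<=` graded_identities (heis_grading (skew_tower K_char2 n)).
  apply: smallest_sub; first exact: graded_identities_T_ideal.
  move=> u [|[m /= mn <-]]; first by apply: skew_tower_identities.
  exact: (zyz_word_identity (skew_tower_has_degree K_char2 n)).
apply: JI; apply: (Jn n.+1); apply: sub_gen_smallest; right.
by exists n.+1 => /=.
Qed.
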